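(* There is a one-to-one correspondence between skeletal $2$-term $HA_\infty$-algebras and tuples $((A,\mu,\alpha),M,\beta,\cdot,\theta)$, where $(A,\mu,\alpha)$ is a hom-associative algebra, $(M,\beta,\cdot)$ is a hom-bimodule over $A$ and $\theta$ is a $3$-cocycle of the hom-associative algebra $A$ with coefficients in the hom-bimodule. Moreover, it extends to a one-to-one correspondence between equivalence classes of skeletal $2$-term $HA_\infty$-algebras and the third Hochschild cohomology $H^3_{\alpha,\beta}(A,M)$.
   Context: Vector spaces are over a field of characteristic zero; the twisting linear maps of the (graded) algebras considered are assumed not identically zero. A hom-associative algebra $(A,\mu,\alpha)$ is a vector space with a bilinear map $\mu$ and a linear map $\alpha$ with $\alpha(\mu(a,b))=\mu(\alpha(a),\alpha(b))$ and $\mu(\alpha(a),\mu(b,c))=\mu(\mu(a,b),\alpha(c))$. A hom-bimodule $(M,\beta,\cdot)$ over it is a vector space $M$ with a linear map $\beta:M\to M$ and bilinear maps $A\otimes M\to M$, $M\otimes A\to M$ with $\beta(a\cdot m)=\alpha(a)\cdot\beta(m)$, $\beta(m\cdot a)=\beta(m)\cdot\alpha(a)$, $\alpha(a)\cdot(b\cdot m)=\mu(a,b)\cdot\beta(m)$, $\beta(m)\cdot\mu(a,b)=(m\cdot a)\cdot\alpha(b)$, $\alpha(a)\cdot(m\cdot b)=(a\cdot m)\cdot\alpha(b)$. Hochschild cohomology: $C^n_{\alpha,\beta}(A,M)=\{f:A^{\otimes n}\to M\ \text{linear}\mid f\circ\alpha^{\otimes n}=\beta\circ f\}$ with $$\delta_{\alpha,\beta}f(a_1,\dots,a_{n+1})=\alpha^{n-1}(a_1)\cdot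 f(a_2,\dots,a_{n+1})+\sum_{i=1}^n(-1)^if(\alpha(a_1),\dots,\alpha(a_{i-1}),\mu(a_i,a_{i+1}),\alpha(a_{i+2}),\dots,\alpha(a_{n+1}))+(-1)^{n+1}f(a_1,\dots,a_n)\cdot\alpha^{n-1}(a_{n+1}),$$ and $H^\bullet_{\alpha,\beta}(A,M)$ is its cohomology; an $n$-cocycle is an $f\in C^n_{\alpha,\beta}(A,M)$ with $\delta_{\alpha,\beta}f=0$. A $2$-term $HA_\infty$-algebra $(A_1\xrightarrow{d}A_0,\mu_2,\mu_3,\alpha_0,\alpha_1)$ consists of a linear map $d:A_1\to A_0$, bilinear maps $\mu_2:A_i\otimes A_j\to A_{i+j}$ (with $A_i=0$ for $i\ne0,1$), a trilinear map $\mu_3:A_0^{\otimes3}\to A_1$, and linear maps $\alpha_i:A_i\to A_i$ with $\alpha_0d=d\alpha_1$, $\alpha_1\mu_3=\mu_3\alpha_0^{\otimes3}$ such that for $a,b,c,e\in A_0$, $m,n\in A_1$: (a) $\mu_2(m,n)=0$; (b) $\alpha_0\mu_2(a,b)=\mu_2(\alpha_0a,\alpha_0b)$; (c) $\alpha_1\mu_2(a,m)=\mu_2(\alpha_0a,\alpha_1m)$; (d) $\alpha_1\mu_2(m,a)=\mu_2(\alpha_1m,\alpha_0a)$; (e) $d\mu_2(a,m)=\mu_2(a,dm)$; (f) $d\mu_2(m,a)=\mu_2(dm,a)$; (g) $\mu_2(dm,n)=\mu_2(m,dn)$; (h) $d\mu_3(a,b,c)=\mu_2(\mu_2(a,b),\alpha_0c)-\mu_2(\alpha_0a,\mu_2(b,c))$;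 (i1) $\mu_3(a,b,dm)=\mu_2(\mu_2(a,b),\alpha_1m)-\mu_2(\alpha_0a,\mu_2(b,m))$; (i2) $\mu_3(a,dm,c)=\mu_2(\mu_2(a,m),\alpha_0c)-\mu_2(\alpha_0a,\mu_2(m,c))$; (i3) $\mu_3(dm,b,c)=\mu_2(\mu_2(m,b),\alpha_0c)-\mu_2(\alpha_1m,\mu_2(b,c))$; (j) $\mu_3(\mu_2(a,b),\alpha_0c,\alpha_0e)-\mu_3(\alpha_0a,\mu_2(b,c),\alpha_0e)+\mu_3(\alpha_0a,\alpha_0b,\mu_2(c,e))=\mu_2(\mu_3(a,b,c),\alpha_0^2e)+\mu_2(\alpha_0^2a,\mu_3(b,c,e))$. It is skeletal if $d=0$. Two skeletal $2$-term $HA_\infty$-algebras $(A_1\xrightarrow{0}A_0,\mu_2,\mu_3,\alpha_0,\alpha_1)$ and $(A_1\xrightarrow{0}A_0,\mu_2',\mu_3',\alpha_0,\alpha_1)$ on the same complex and with the same $\alpha_0,\alpha_1$ are equivalent if $\mu_2=\mu_2'$ and there is a linear map $\sigma:A_0\otimes A_0\to A_1$ with $\alpha_1\sigma(a,b)=\sigma(\alpha_0a,\alpha_0b)$ and $$\mu_3'(a,b,c)=\mu_3(a,b,c)+\mu_2(\alpha_0a,\sigma(b,c))-\sigma(\mu_2(a,b),\alpha_0c)+\sigma(\alpha_0a,\mu_2(b,c))-\mu_2(\sigma(a,b),\alpha_0c)$$ for all $a,b,c\in A_0$. *)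

(* Defs.v *)
From HB Require Import structures.
From mathcomp Require Import all_boot all_order all_algebra.
From mathcomp Require Import classical_sets functions.

Set Implicit Arguments.
Unset Strict Implicit.
Unset Printing Implicit Defensive.

Import GRing.Theory.
Local Open Scope ring_scope.
Local Open Scope classical_set_scope.

(* Structures are records of bare operations; the axioms are separate
   propositions, so that equality of structures is equality of carriers and
   operations. Linear maps on a tensor power are multilinear maps. *)

Notation is_bilinear f := (bilinear_for *:%R *:%R f).

Definition is_trilinear (K : fieldType) (U V : lmodType K)
    (f : U -> U -> U -> V) : Prop :=
  [/\ forall b c, linear (fun a => f a b c),
      forall a c, linear (fun b => f a b c)
    & forall a b, linear (fun c => f a b c)].

Definition is_multilinear (K : fieldType) (U V : lmodType K) (n : nat)
    (f : {ffun 'I_n -> U} -> V) : Prop :=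
  forall (i : 'I_n) (v : {ffun 'I_n -> U}),
    linear (fun a : U => f [ffun j => if j == i then a else v j]).

Record hom_pair (K : fieldType) (A M : lmodType K) := HomPair {
  mu : A -> A -> A;
  alpha : A -> A;
  beta : M -> M;
  lact : A -> M -> M;
  ract : M -> A -> M
}.

Record is_hom_assoc (K : fieldType) (A M : lmodType K) (B : hom_pair A M) :
    Prop := {
  hom_mu_bilinear : is_bilinear (mu B);
  hom_alpha_linear : linear (alpha B);
  hom_alpha_neq0 : exists a, alpha B a != 0;
  hom_alphaM : forall a b, alpha B (mu B a b) = mu B (alpha B a) (alpha B b);
  hom_assoc : forall a b c,
    mu B (alpha B a) (mu B b c) = mu B (mu B a b) (alpha B c)
}.

Record is_hom_bimod (K : fieldType) (A M : lmodType K) (B : hom_pair A M) :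
    Prop := {
  bim_beta_linear : linear (beta B);
  bim_lact_bilinear : is_bilinear (lact B);
  bim_ract_bilinear : is_bilinear (ract B);
  bim_beta_lact : forall a m,
    beta B (lact B a m) = lact B (alpha B a) (beta B m);
  bim_beta_ract : forall m a,
    beta B (ract B m a) = ract B (beta B m) (alpha B a);
  bim_lact_lact : forall a b m,
    lact B (alpha B a) (lact B b m) = lact B (mu B a b) (beta B m);
  bim_ract_ract : forall m a b,
    ract B (beta B m) (mu B a b) = ract B (ract B m a) (alpha B b);
  bim_lact_ract : forall a m b,
    lact B (alpha B a) (ract B m b) = ract B (lact B a m) (alpha B b)
}.

Section Hochschild.
Variables (K : fieldType) (A M : lmodType K) (B : hom_pair A M).

Definition is_cochain (n : nat) (f : {ffun 'I_n -> A} -> M) : Prop :=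
  is_multilinear f /\
  forall v : {ffun 'I_n -> A}, f [ffun i => alpha B (v i)] = beta B (f v).

(* For i counted from 0 :
   (alpha v_0, .., alpha v_(i-1), mu v_i v_(i+1), alpha v_(i+2), ..) *)
Definition hoch_merge (n : nat) (v : {ffun 'I_n.+1 -> A}) (i : 'I_n) :
    {ffun 'I_n -> A} :=
  [ffun j : 'I_n =>
     if (j < i)%N then alpha B (v (widen_ord (leqnSn n) j))
     else if j == i then mu B (v (widen_ord (leqnSn n) j)) (v (lift ord0 j))
     else alpha B (v (lift ord0 j))].

(* The complex starts in degree n = 1. *)
Definition hoch_delta (n : nat) (f : {ffun 'I_n -> A} -> M)
    (v : {ffun 'I_n.+1 -> A}) : M :=
  lact B (iter n.-1 (alpha B) (v ord0)) (f [ffun j => v (lift ord0 j)])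
  + \sum_(i < n) (-1) ^+ i.+1 *: f (hoch_merge v i)
  + (-1) ^+ n.+1 *: ract B (f [ffun j => v (widen_ord (leqnSn n) j)])
                           (iter n.-1 (alpha B) (v ord_max)).

Definition is_cocycle (n : nat) (f : {ffun 'I_n -> A} -> M) : Prop :=
  is_cochain f /\ forall v, hoch_delta f v = 0.

Definition is_coboundary (n : nat) : ({ffun 'I_n -> A} -> M) -> Prop :=
  match n return ({ffun 'I_n -> A} -> M) -> Prop with
  | n'.+2 => fun f => exists2 g : {ffun 'I_n'.+1 -> A} -> M,
                        is_cochain g & forall v, f v = hoch_delta g v
  | _ => fun f => forall v, f v = 0
  end.

(* H^n as the set of cosets, in the space of cocycles, of the space of
   coboundaries. *)
Definition hoch_cohomology (n : nat) : set (set ({ffun 'I_n -> A} -> M)) :=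
  [set C | exists2 f, is_cocycle f &
     C = [set g | is_cocycle g /\ is_coboundary (fun v => g v - f v)]].

End Hochschild.

Arguments hoch_cohomology {K A M} B n.
Arguments is_cocycle {K A M} B n f.
Arguments is_coboundary {K A M} B n f.

(* The component of mu2 on A1 (x) A1 takes values in A_2, the zero space. *)
Record ha_ops (K : fieldType) (A0 A1 : lmodType K) := HAOps {
  ha_d : A1 -> A0;
  ha_mu00 : A0 -> A0 -> A0;
  ha_mu01 : A0 -> A1 -> A1;
  ha_mu10 : A1 -> A0 -> A1;
  ha_mu11 : A1 -> A1 -> 'rV[K]_0;
  ha_mu3 : A0 -> A0 -> A0 -> A1;
  ha_alpha0 : A0 -> A0;
  ha_alpha1 : A1 -> A1
}.

Record is_HA2 (K : fieldType) (A0 A1 : lmodType K) (X : ha_ops A0 A1) :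
    Prop := {
  ha_d_linear : linear (ha_d X);
  ha_mu00_bilinear : is_bilinear (ha_mu00 X);
  ha_mu01_bilinear : is_bilinear (ha_mu01 X);
  ha_mu10_bilinear : is_bilinear (ha_mu10 X);
  ha_mu11_bilinear : is_bilinear (ha_mu11 X);
  ha_mu3_trilinear : is_trilinear (ha_mu3 X);
  ha_alpha0_linear : linear (ha_alpha0 X);
  ha_alpha1_linear : linear (ha_alpha1 X);
  ha_alpha0_neq0 : exists a, ha_alpha0 X a != 0;
  ha_alpha_d : forall m, ha_alpha0 X (ha_d X m) = ha_d X (ha_alpha1 X m);
  ha_alpha_mu3 : forall a b c,
    ha_alpha1 X (ha_mu3 X a b c)
    = ha_mu3 X (ha_alpha0 X a) (ha_alpha0 X b) (ha_alpha0 X c);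
  (* The axioms (a)-(j) of a 2-term HA_oo-algebra; ha_dd is (d). *)
  ha_a : forall m n, ha_mu11 X m n = 0;
  ha_b : forall a b,
    ha_alpha0 X (ha_mu00 X a b) = ha_mu00 X (ha_alpha0 X a) (ha_alpha0 X b);
  ha_c : forall a m,
    ha_alpha1 X (ha_mu01 X a m) = ha_mu01 X (ha_alpha0 X a) (ha_alpha1 X m);
  ha_dd : forall m a,
    ha_alpha1 X (ha_mu10 X m a) = ha_mu10 X (ha_alpha1 X m) (ha_alpha0 X a);
  ha_e : forall a m, ha_d X (ha_mu01 X a m) = ha_mu00 X a (ha_d X m);
  ha_f : forall m a, ha_d X (ha_mu10 X m a) = ha_mu00 X (ha_d X m) a;
  ha_g : forall m n, ha_mu01 X (ha_d X m) n = ha_mu10 X m (ha_d X n);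
  ha_h : forall a b c,
    ha_d X (ha_mu3 X a b c)
    = ha_mu00 X (ha_mu00 X a b) (ha_alpha0 X c)
      - ha_mu00 X (ha_alpha0 X a) (ha_mu00 X b c);
  ha_i1 : forall a b m,
    ha_mu3 X a b (ha_d X m)
    = ha_mu01 X (ha_mu00 X a b) (ha_alpha1 X m)
      - ha_mu01 X (ha_alpha0 X a) (ha_mu01 X b m);
  ha_i2 : forall a m c,
    ha_mu3 X a (ha_d X m) c
    = ha_mu10 X (ha_mu01 X a m) (ha_alpha0 X c)
      - ha_mu01 X (ha_alpha0 X a) (ha_mu10 X m c);
  ha_i3 : forall m b c,
    ha_mu3 X (ha_d X m) b c
    = ha_mu10 X (ha_mu10 X m b) (ha_alpha0 X c)
      - ha_mu10 X (ha_alpha1 X m) (ha_mu00 X b c);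
  ha_j : forall a b c e,
    ha_mu3 X (ha_mu00 X a b) (ha_alpha0 X c) (ha_alpha0 X e)
    - ha_mu3 X (ha_alpha0 X a) (ha_mu00 X b c) (ha_alpha0 X e)
    + ha_mu3 X (ha_alpha0 X a) (ha_alpha0 X b) (ha_mu00 X c e)
    = ha_mu10 X (ha_mu3 X a b c) (ha_alpha0 X (ha_alpha0 X e))
      + ha_mu01 X (ha_alpha0 X (ha_alpha0 X a)) (ha_mu3 X b c e)
}.

Definition is_skeletal_HA2 (K : fieldType) (A0 A1 : lmodType K)
    (X : ha_ops A0 A1) : Prop :=
  is_HA2 X /\ forall m, ha_d X m = 0.

(* Only meant for X and Y both satisfying is_skeletal_HA2. *)
Definition ha_equiv (K : fieldType) (A0 A1 : lmodType K) (X Y : ha_ops A0 A1) :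
    Prop :=
  [/\ ha_alpha0 X = ha_alpha0 Y /\ ha_alpha1 X = ha_alpha1 Y,
      [/\ ha_mu00 X = ha_mu00 Y, ha_mu01 X = ha_mu01 Y,
          ha_mu10 X = ha_mu10 Y & ha_mu11 X = ha_mu11 Y]
    & exists sigma : A0 -> A0 -> A1,
      [/\ is_bilinear sigma,
          forall a b,
            ha_alpha1 X (sigma a b) = sigma (ha_alpha0 X a) (ha_alpha0 X b)
        & forall a b c,
            ha_mu3 Y a b c
            = ha_mu3 X a b c
              + ha_mu01 X (ha_alpha0 X a) (sigma b c)
              - sigma (ha_mu00 X a b) (ha_alpha0 X c)
              + sigma (ha_alpha0 X a) (ha_mu00 X b c)
              - ha_mu10 X (sigma a b) (ha_alpha0 X c)]].

Definition ha_pair (K : fieldType) (A0 A1 : lmodType K) (X : ha_ops A0 A1) :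
    hom_pair A0 A1 :=
  HomPair (ha_mu00 X) (ha_alpha0 X) (ha_alpha1 X) (ha_mu01 X) (ha_mu10 X).

Definition ha_theta (K : fieldType) (A0 A1 : lmodType K) (X : ha_ops A0 A1) :
    {ffun 'I_3 -> A0} -> A1 :=
  fun v => ha_mu3 X (v 0) (v 1) (v 2).

Record two_term (K : fieldType) := TwoTerm {
  tt_A0 : lmodType K;
  tt_A1 : lmodType K;
  tt_ops : ha_ops tt_A0 tt_A1
}.

Record hom_tuple (K : fieldType) := HomTuple {
  ht_A : lmodType K;
  ht_M : lmodType K;
  ht_pair : hom_pair ht_A ht_M;
  ht_theta : {ffun 'I_3 -> ht_A} -> ht_M
}.

Definition is_cocycle_tuple (K : fieldType) (T : hom_tuple K) : Prop :=
  [/\ is_hom_assoc (ht_pair T), is_hom_bimod (ht_pair T)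
    & is_cocycle (ht_pair T) 3 (@ht_theta K T)].

Definition tuple_of_HA2 (K : fieldType) (X : two_term K) : hom_tuple K :=
  HomTuple (ha_pair (tt_ops X)) (ha_theta (tt_ops X)).

(* The universe of "set" is too small for the type of all such algebras, hence
   this variant of "set_bij". *)
Definition bij_between (S T : Type) (P : S -> Prop) (Q : T -> Prop)
    (F : S -> T) : Prop :=
  [/\ forall X, P X -> Q (F X),
      forall X Y, P X -> P Y -> F X = F Y -> X = Y
    & forall Z, Q Z -> exists2 X, P X & F X = Z].

(* Equivalent algebras have the same underlying pair ((A, mu, alpha),
   (M, beta, .)), so the equivalence classes are distributed over these pairs;
   this is the set of those lying over B. *)
Definition skeletal_classes (K : fieldType) (A M : lmodType K)
    (B : hom_pair A M) : set (set (ha_ops A M)) :=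
  [set C | exists2 X, is_skeletal_HA2 X /\ ha_pair X = B &
     C = [set Y | is_skeletal_HA2 Y /\ ha_equiv X Y]].

(* Main.v *)
(* When d = 0, axioms (b)-(d) and (h)-(i3) are those of a hom-associative algebra
   and a hom-bimodule, (j) is the vanishing of the Hochschild differential of
   mu_3, and (e)-(g) hold trivially. Two structures with the same underlying
   pair are equivalent exactly when their mu_3 differ by the coboundary of
   sigma, so an equivalence class is carried onto a coset of coboundaries. *)

Require Import Defs.
From HB Require Import structures.
From mathcomp Require Import all_boot all_order all_algebra.
From mathcomp Require Import boolp classical_sets functions.

Import GRing.Theory.
Local Open Scope ring_scope.
Local Open Scope classical_set_scope.

(** * Short tuples with named entries, and two auxiliary identities *)

Definition vec2 {T : Type} (a b : T) : {ffun 'I_2 -> T} :=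
  finfun (tnth [tuple a; b]).
Definition vec3 {T : Type} (a b c : T) : {ffun 'I_3 -> T} :=
  finfun (tnth [tuple a; b; c]).
Definition vec4 {T : Type} (a b c e : T) : {ffun 'I_4 -> T} :=
  finfun (tnth [tuple a; b; c; e]).

Lemma vec2E {T : Type} (v : {ffun 'I_2 -> T}) : v = vec2 (v 0) (v 1).
Proof.
apply/ffunP; case=> [[|[|//]] hi]; rewrite ffunE; congr (v _); exact: val_inj.
Qed.

Lemma finfun_vec2 {T : Type} (F : 'I_2 -> T) : finfun F = vec2 (F 0) (F 1).
Proof. by rewrite [LHS]vec2E !ffunE. Qed.

Lemma vec3E {T : Type} (v : {ffun 'I_3 -> T}) : v = vec3 (v 0) (v 1) (v 2).
Proof.
apply/ffunP; case=> [[|[|[|//]]] hi]; rewrite ffunE; congr (v _);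
  exact: val_inj.
Qed.

Lemma finfun_vec3 {T : Type} (F : 'I_3 -> T) : finfun F = vec3 (F 0) (F 1) (F 2).
Proof. by rewrite [LHS]vec3E !ffunE. Qed.

Lemma vec4E {T : Type} (v : {ffun 'I_4 -> T}) :
  v = vec4 (v 0) (v 1) (v 2) (v 3).
Proof.
apply/ffunP; case=> [[|[|[|[|//]]]] hi]; rewrite ffunE; congr (v _);
  exact: val_inj.
Qed.

Lemma linear_at0 (K : fieldType) (U V : lmodType K) (f : U -> V) :
  linear f -> f 0 = 0.
Proof.
by move=> fL; have := fL (-1) 0 0; rewrite scaler0 add0r scaleN1r addNr.
Qed.

(** Groups the five terms of a degree 3 differential as the right side of axiom (j) minus its left
    side. *)
Lemma delta3_rearrange (V : zmodType) (p q r s t : V) :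
  p - q + r - s + t = t + p - (q - r + s).
Proof. by rewrite !opprD opprK [LHS]addrC !addrA. Qed.

(** * Multilinear maps in two and three variables, in curried form *)

Section Multilinear.
Variables (K : fieldType) (U V : lmodType K).

Lemma is_multilinear2 (f : {ffun 'I_2 -> U} -> V) :
  is_multilinear f <->
  bilinear_for *:%R *:%R (fun a b => f (vec2 a b)).
Proof.
split=> [fM | [f1 f2]].
- split=> [b|a] k x y.
  (* The entry 0 is a filler: it sits at the index whose value is overwritten. *)
  + have := fM 0 (vec2 0 b) k x y.
    by rewrite !finfun_vec2 ?ffunE /=.
  + have := fM 1 (vec2 a 0) k x y.
    by rewrite !finfun_vec2 ?ffunE /=.
- case=> [[|[|//]] hi] v k x y;
    rewrite !finfun_vec2 ?ffunE /=;
    [exact: f1 | exact: f2].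
Qed.

Lemma is_multilinear3 (f : {ffun 'I_3 -> U} -> V) :
  is_multilinear f <-> is_trilinear (fun a b c => f (vec3 a b c)).
Proof.
split=> [fM | [f1 f2 f3]].
- split=> [b c|a c|a b] k x y.
  + have := fM 0 (vec3 0 b c) k x y.
    by rewrite !finfun_vec3 ?ffunE /=.
  + have := fM 1 (vec3 a 0 c) k x y.
    by rewrite !finfun_vec3 ?ffunE /=.
  + have := fM 2 (vec3 a b 0) k x y.
    by rewrite !finfun_vec3 ?ffunE /=.
- case=> [[|[|[|//]]] hi] v k x y;
    rewrite !finfun_vec3 ?ffunE /=;
    [exact: f1 | exact: f2 | exact: f3].
Qed.

End Multilinear.

(** * Cochains and differentials in degrees two and three *)

Section LowDegree.
Variables (K : fieldType) (A M : lmodType K) (B : hom_pair A M).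

Lemma is_cochain2 (f : {ffun 'I_2 -> A} -> M) :
  is_cochain B f <->
  bilinear_for *:%R *:%R (fun a b => f (vec2 a b)) /\
  forall a b, beta B (f (vec2 a b)) = f (vec2 (alpha B a) (alpha B b)).
Proof.
rewrite -is_multilinear2; split=> -[fM fab]; split=> //.
- by move=> a b; rewrite -fab finfun_vec2 !ffunE.
- by move=> v; rewrite [v in RHS]vec2E fab finfun_vec2.
Qed.

Lemma is_cochain3 (f : {ffun 'I_3 -> A} -> M) :
  is_cochain B f <->
  is_trilinear (fun a b c => f (vec3 a b c)) /\
  forall a b c, beta B (f (vec3 a b c))
    = f (vec3 (alpha B a) (alpha B b) (alpha B c)).
Proof.
rewrite -is_multilinear3; split=> -[fM fab]; split=> //.
- by move=> a b c; rewrite -fab finfun_vec3 !ffunE.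
- by move=> v; rewrite [v in RHS]vec3E fab finfun_vec3.
Qed.

(** The four terms are, in the same order, those that [sigma] contributes in [ha_equiv]. *)
Lemma hoch_delta2 (f : {ffun 'I_2 -> A} -> M) a b c :
  hoch_delta B f (vec3 a b c)
  = lact B (alpha B a) (f (vec2 b c)) - f (vec2 (mu B a b) (alpha B c))
    + f (vec2 (alpha B a) (mu B b c)) - ract B (f (vec2 a b)) (alpha B c).
Proof.
rewrite /hoch_delta !big_ord_recr big_ord0 /= add0r.
rewrite /hoch_merge !finfun_vec2.
(* All indices are in range, so the default [a] is never returned; with [nth] the lifted and widened
   ordinals compute as numbers. *)
rewrite !ffunE /= !(tnth_nth a) /=.
by rewrite expr1 sqrrN expr1n exprS sqrrN expr1n mulr1 !scaleN1r !scale1r !addrA.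
Qed.

(** The exponent [n.-1] is 2 here, which produces the squares of the twisting map in axiom (j). *)
Lemma hoch_delta3 (f : {ffun 'I_3 -> A} -> M) a b c e :
  hoch_delta B f (vec4 a b c e)
  = lact B (alpha B (alpha B a)) (f (vec3 b c e))
    - f (vec3 (mu B a b) (alpha B c) (alpha B e))
    + f (vec3 (alpha B a) (mu B b c) (alpha B e))
    - f (vec3 (alpha B a) (alpha B b) (mu B c e))
    + ract B (f (vec3 a b c)) (alpha B (alpha B e)).
Proof.
rewrite /hoch_delta !big_ord_recr big_ord0 /= add0r.
rewrite /hoch_merge !finfun_vec3.
rewrite !ffunE /= !(tnth_nth a) /=.
rewrite expr1 !exprS expr0 !mulr1 !mulrN !mulN1r !opprK.
by rewrite !scaleN1r !scale1r !addrA.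
Qed.

End LowDegree.

(** * Skeletal algebras against cocycles, and equivalences against coboundaries *)

Section Skeletal.
Variables (K : fieldType) (A M : lmodType K).
Implicit Types (X Y : ha_ops A M) (B : hom_pair A M).

(** The inverse construction, from a pair and a cocycle back to an algebra. *)
Definition ha_of_pair B (theta : {ffun 'I_3 -> A} -> M) : ha_ops A M :=
  HAOps (fun=> 0) (mu B) (lact B) (ract B) (fun _ _ => 0)
        (fun a b c => theta (vec3 a b c)) (alpha B) (beta B).

Lemma ha_pair_of_pair B theta : ha_pair (ha_of_pair B theta) = B.
Proof. by case: B. Qed.

Lemma ha_theta_of_pair B theta : ha_theta (ha_of_pair B theta) = theta.
Proof. by apply: funext => v; rewrite [v in RHS]vec3E. Qed.

Lemma ha_theta_vec3 X a b c : ha_theta X (vec3 a b c) = ha_mu3 X a b c.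
Proof. by rewrite /ha_theta !ffunE. Qed.

Lemma ha_of_pairK X : (forall m, ha_d X m = 0) ->
  ha_of_pair (ha_pair X) (ha_theta X) = X.
Proof.
case: X => d m00 m01 m10 m11 m3 a0 a1 /= d0; congr HAOps.
- by apply: funext => m; rewrite d0.
(* [ha_mu11] takes values in rows of width 0, so it can only be the zero map. *)
- by apply: funext => m; apply: funext => n; rewrite [RHS]thinmx0.
- by do 3!apply: funext => ?; rewrite ha_theta_vec3.
Qed.

Lemma is_skeletal_HA2P X :
  is_skeletal_HA2 X <->
  (forall m, ha_d X m = 0) /\
  [/\ is_hom_assoc (ha_pair X), is_hom_bimod (ha_pair X)
    & is_cocycle (ha_pair X) 3 (ha_theta X)].
Proof.
have thetaE : (fun a b c => ha_theta X (vec3 a b c)) = ha_mu3 X.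
  by do 3!apply: funext => ?; rewrite ha_theta_vec3.
split=> [[HX d0] | [d0 [HA HM [/is_cochain3[]]]]].
- have [mu3a mu3b mu3c] := ha_mu3_trilinear HX.
  split=> //; split; split => //=; try by case: HX.
  (* With d = 0 the left sides of (h) and (i1)-(i3) vanish, the latter by linearity of [ha_mu3] in
     each slot. The right sides then give hom-associativity and the three bimodule laws. *)
  + by move=> a b c; apply/esym/eqP; rewrite -subr_eq0 -(ha_h HX) d0.
  + move=> a b m; apply/esym/eqP; rewrite -subr_eq0 -(ha_i1 HX) d0.
    by rewrite (linear_at0 _ _ _ _ (mu3c _ _)).
  + move=> m a b; apply/esym/eqP; rewrite -subr_eq0 -(ha_i3 HX) d0.
    by rewrite (linear_at0 _ _ _ _ (mu3a _ _)).
  + move=> a m b; apply/esym/eqP; rewrite -subr_eq0 -(ha_i2 HX) d0.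
    by rewrite (linear_at0 _ _ _ _ (mu3b _ _)).
  + apply/is_cochain3; rewrite thetaE; split; first by case: HX.
    by move=> a b c; rewrite !ha_theta_vec3 /=; case: HX.
  + move=> v; rewrite [v]vec4E hoch_delta3 !ha_theta_vec3 /=.
    by rewrite delta3_rearrange (ha_j HX) subrr.
- rewrite thetaE => mu3L mu3C cocy.
  have [mu3a mu3b mu3c] := mu3L.
  split=> //; case: (HA) (HM) => /= ? ? ? ? hassoc [] /= ? [lL lR] [rL rR] ? ? ll rr lr.
  (* Products with a zero argument vanish; (e), (f) and (g) come down to this when d = 0. *)
  have l0 a : ha_mu01 X a 0 = 0 by exact: linear_at0 (lR a).
  have r0 a : ha_mu10 X 0 a = 0 by exact: linear_at0 (rL a).
  have m0 m : ha_mu01 X 0 m = 0 by exact: linear_at0 (lL m).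
  have n0 m : ha_mu10 X m 0 = 0 by exact: linear_at0 (rR m).
  have [hm1 hm2] := hom_mu_bilinear HA.
  have u0 a : ha_mu00 X a 0 = 0 by exact: linear_at0 (hm2 a).
  have w0 a : ha_mu00 X 0 a = 0 by exact: linear_at0 (hm1 a).
  split => //.
  + by move=> k x y; rewrite !d0 scaler0 addr0.
  + by split=> ? k x y; rewrite [LHS]thinmx0 [RHS]thinmx0.
  + by move=> m; rewrite !d0; apply: linear_at0 (hom_alpha_linear HA).
  + by move=> a b c; have := mu3C a b c; rewrite !ha_theta_vec3.
  + by move=> m n; rewrite [LHS]thinmx0.
  + by move=> a m; rewrite !d0 u0.
  + by move=> a m; rewrite !d0 w0.
  + by move=> m n; rewrite !d0 m0 n0.
  + by move=> a b c; rewrite d0 hassoc subrr.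
  + by move=> a b m; rewrite d0 ll subrr; apply: linear_at0 (mu3c _ _).
  + by move=> a m c; rewrite d0 lr subrr; apply: linear_at0 (mu3b _ _).
  + by move=> m b c; rewrite d0 rr subrr; apply: linear_at0 (mu3a _ _).
  + move=> a b c e; have := cocy (vec4 a b c e).
    rewrite hoch_delta3 !ha_theta_vec3 delta3_rearrange /=.
    by move=> /eqP; rewrite subr_eq0 => /eqP.
Qed.

Lemma is_skeletal_HA2_of_pair B theta :
  is_hom_assoc B -> is_hom_bimod B -> is_cocycle B 3 theta ->
  is_skeletal_HA2 (ha_of_pair B theta).
Proof.
move=> HA HM Htheta; apply/is_skeletal_HA2P.
by rewrite ha_pair_of_pair ha_theta_of_pair.
Qed.

Lemma ha_pair_theta_inj X Y :
  (forall m, ha_d X m = 0) -> (forall m, ha_d Y m = 0) ->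
  ha_pair X = ha_pair Y -> ha_theta X = ha_theta Y -> X = Y.
Proof. by move=> dX dY eB eT; rewrite -(ha_of_pairK X dX) eB eT ha_of_pairK. Qed.

Lemma ha_equivP X Y :
  ha_equiv X Y <->
  ha_pair X = ha_pair Y /\
  is_coboundary (ha_pair X) 3 (fun v => ha_theta Y v - ha_theta X v).
Proof.
split.
- case=> [[e0 e1] [e00 e01 e10 _] [s [sL sC sE]]].
  split; first by rewrite /ha_pair e0 e1 e00 e01 e10.
  exists (fun v => s (v 0) (v 1)).
  + apply/is_cochain2; split; last by move=> a b; rewrite !ffunE; apply: sC.
    by case: sL => sl sr; split=> x k y z; rewrite !ffunE; [apply: sl|apply: sr].
  + move=> v; rewrite [v]vec3E hoch_delta2 !ha_theta_vec3 sE !ffunE /=.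
    by rewrite -!addrA addrC !addrA subrK.
- case=> eXY [g /is_cochain2 [gL gC] gE].
  case: (eXY) => e00 e0 e1 e01 e10.
  split => //; first split=> //.
    by do 2!apply: funext => ?; rewrite [LHS]thinmx0 [RHS]thinmx0.
  exists (fun a b => g (vec2 a b)); split=> // a b c.
  have := gE (vec3 a b c); rewrite hoch_delta2 !ha_theta_vec3 /= => /eqP.
  by rewrite subr_eq addrC !addrA => /eqP.
Qed.

(** Every cocycle in the coset is attained: together with the pair of [X] it defines a skeletal
    algebra, equivalent to [X] by [ha_equivP]. *)
Lemma image_ha_theta_class X :
  is_skeletal_HA2 X ->
  @ha_theta K A M @` [set Y | is_skeletal_HA2 Y /\ ha_equiv X Y]
  = [set g | is_cocycle (ha_pair X) 3 g /\
             is_coboundary (ha_pair X) 3 (fun v => g v - ha_theta X v)].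
Proof.
move=> /is_skeletal_HA2P[_ [HA HM _]]; apply/seteqP; split=> [f [Y] | g] /=.
- by move=> [/is_skeletal_HA2P[_ [_ _ cY]] /ha_equivP[eXY ?]] <-; rewrite {1}eXY.
- move=> [cg bg]; exists (ha_of_pair (ha_pair X) g).
  + split; first exact: is_skeletal_HA2_of_pair.
    by apply/ha_equivP; rewrite ha_pair_of_pair ha_theta_of_pair.
  + exact: ha_theta_of_pair.
Qed.

(* A class over B is recovered from its image, since a skeletal algebra over B
   is determined by its cocycle. *)
Lemma skeletal_classE B C :
  skeletal_classes B C ->
  C = [set Y | [/\ is_skeletal_HA2 Y, ha_pair Y = B
                 & (@ha_theta K A M @` C) (ha_theta Y)]].
Proof.
case=> X [skX pX] ->; apply/seteqP; split=> Y /=.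
- move=> [skY eXY]; split=> //; last by exists Y.
  by rewrite -pX; case/ha_equivP: eXY.
- move=> [skY pY [Z [skZ eXZ] tZY]].
  suff <- : Z = Y by [].
  apply: ha_pair_theta_inj tZY; [by case: skZ | by case: skY |].
  by rewrite pY -pX; case/ha_equivP: eXZ.
Qed.

End Skeletal.

Theorem theorem4p6 (K : fieldType) (charK0 : [pchar K] =i pred0) :
  bij_between (fun X : two_term K => is_skeletal_HA2 (tt_ops X))
              (@is_cocycle_tuple K) (@tuple_of_HA2 K)
  /\
  (forall (A M : lmodType K) (B : hom_pair A M),
     is_hom_assoc B -> is_hom_bimod B ->
     set_bij (skeletal_classes B) (hoch_cohomology B 3)
             (fun C : set (ha_ops A M) => (@ha_theta K A M) @` C)).
Proof.
split.
(* [G] is the two-sided inverse: [GK] gives injectivity, and [G T] is the preimage of [T]. *)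
- pose G (T : hom_tuple K) := TwoTerm (ha_of_pair _ _ _ (ht_pair T) (@ht_theta K T)).
  have GK (X : two_term K) : is_skeletal_HA2 (tt_ops X) -> G (tuple_of_HA2 X) = X.
    by case: X => A0 A1 X [_ d0]; rewrite /G /= ha_of_pairK.
  split=> [X /is_skeletal_HA2P[] // | X Y skX skY eXY | T [HA HM HT]].
    by rewrite -(GK X skX) eXY GK.
  exists (G T); first exact: is_skeletal_HA2_of_pair.
  by case: T {HA HM HT} => A M B t; rewrite /tuple_of_HA2 /= ha_pair_of_pair
    ha_theta_of_pair.
- move=> A M B HA HM; split.
  + move=> _ [X [skX pX] ->]; exists (ha_theta X).
      by rewrite -pX; case/is_skeletal_HA2P: skX => _ [].
    by rewrite image_ha_theta_class // pX.
  (* Each class is rebuilt from [B] and its image alone, so equal images force equal classes. *)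
  + move=> C D /set_mem CB /set_mem DB eCD.
    by rewrite (skeletal_classE _ _ _ _ _ CB) (skeletal_classE _ _ _ _ _ DB) eCD.
  (* The coset of [f] is the image of the class of the algebra built from [B] and [f]. *)
  + move=> _ [f cf ->]; pose X := ha_of_pair _ _ _ B f.
    have skX : is_skeletal_HA2 X by exact: is_skeletal_HA2_of_pair.
    exists [set Y | is_skeletal_HA2 Y /\ ha_equiv X Y].
      by exists X => //; split=> //; exact: ha_pair_of_pair.
    by rewrite image_ha_theta_class // ha_pair_of_pair ha_theta_of_pair.
Qed.
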